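(* Let $(G,P,\theta)$ be an algebraic dynamical system such that $G$ and $P$ are abelian and $[G:\theta_p(G)]<\infty$ for all $p\in P$. The map $\psi\mapsto\beta_\psi$, where $\beta_\psi(u_gs_p)=u_g\psi_ps_p$ for $g\in G$, $p\in P$, defines an injective group homomorphism ${\rm Hom}_\theta(P,C(\widehat{G},\mathbb{T}))\to{\rm Aut}_{C^*(G)}\mathcal{Q}(G\rtimes_\theta P)$. If $C^*(G)$ is maximal abelian in $\mathcal{Q}(G\rtimes_\theta P)$, then this homomorphism is an isomorphism and $${\rm End}_{C^*(G)}\mathcal{Q}(G\rtimes_\theta P)={\rm Aut}_{C^*(G)}\mathcal{Q}(G\rtimes_\theta P)\cong{\rm Hom}_\theta(P,C(\widehat{G},\mathbb{T})).$$
   Context: An algebraic dynamical system is a triple $(G,P,\theta)$ where $G$ is a countable discrete group; $P$ is a right LCM semigroup, i.e. a countable left cancellative monoid in which the intersection of two principal right ideals is either empty or another principal right ideal; and $\theta$ is an action of $P$ on $G$ by injective group endomorphisms $\theta_p$ which respects the order: $pP\cap qP=rP$ implies $\theta_p(G)\cap\theta_q(G)=\theta_r(G)$. Write $N_p=[G:\theta_p(G)]$. An abelian $P$ is directed with respect to $p\geq q\Leftrightarrow p\in qP$. For directed $P$, the boundary quotient $\mathcal{Q}(G\rtimes_\theta P)$ is the universal $C^*$-algebra generated by a unitary representation $u$ of $G$ and a representation $s$ of the monoid $P$ by isometries satisfying (I) $s_pu_g=u_{\theta_p(g)}s_p$; (II) $s_p^*u_gs_q=u_{g_1}s_{p'}s_{q'}^*u_{g_2}$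 if $g=\theta_p(g_1)\theta_q(g_2)$ and $pP\cap qP=pp'P$, $pp'=qq'$, and $s_p^*u_gs_q=0$ otherwise; (III) $\sum_{[g]\in G/\theta_p(G)}u_gs_ps_p^*u_g^*=1$ whenever $N_p<\infty$. $C^*(G)$ is identified with the $C^*$-subalgebra of $\mathcal{Q}(G\rtimes_\theta P)$ generated by $\{u_g\mid g\in G\}$, and with $C(\widehat{G})$ via $u_g\mapsto[\chi\mapsto\chi(g)]$, where $\widehat{G}$ is the Pontryagin dual of $G$; thus $C(\widehat{G},\mathbb{T})$ is the unitary group of $C^*(G)$. ${\rm Aut}_{C^*(G)}\mathcal{Q}(G\rtimes_\theta P)$ and ${\rm End}_{C^*(G)}\mathcal{Q}(G\rtimes_\theta P)$ denote the $*$-automorphisms and $*$-endomorphisms, respectively, of $\mathcal{Q}(G\rtimes_\theta P)$ that fix $C^*(G)$ pointwise. A map $\psi\colon P\to C(\widehat{G},\mathbb{T})$, $p\mapsto\psi_p$, is a $\theta$-twisted homomorphism if $\psi_{pq}=\psi_p\,\tilde{\theta}_p(\psi_q)$ for all $p,q\in P$, where $\tilde{\theta}_p$ is the endomorphism of $C^*(G)\cong C(\widehat{G})$ with $\tilde{\theta}_p(u_g)=u_{\theta_p(g)}$. ${\rm Hom}_\theta(P,C(\widehat{G},\mathbb{T}))$ is the abelian group of all $\theta$-twisted homomorphisms under pointwise multiplication. *)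

(* Defs.v *)
From HB Require Import structures.
From mathcomp Require Import all_boot all_order all_algebra all_fingroup.
From mathcomp Require Import complex.
From mathcomp Require Import all_classical all_reals all_analysis.

Set Implicit Arguments.
Unset Strict Implicit.
Unset Printing Implicit Defensive.

Import Order.TTheory GRing.Theory Num.Theory.
Import numFieldNormedType.Exports.

Local Open Scope classical_set_scope.
Local Open Scope ring_scope.

(* The complex numbers, typed so that the topology and the norm which the
   library puts on every numClosedFieldType are inferred. *)
Definition Cplx (R : realType) : numClosedFieldType := R[i].

(* The zero algebra is allowed.  The library has no structure joining rings
   and normed modules, so the ring operations are fields here, and the ring
   structure is then attached to the carrier [cstar_sort A]. *)
Record cstarAlgebra (R : realType) := CStarAlgebra {
  cstar_module : completeNormedModType (Cplx R);
  cstar_one : cstar_module;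
  cstar_mul : cstar_module -> cstar_module -> cstar_module;
  cstar_star : cstar_module -> cstar_module;
  cstar_mulA : associative cstar_mul;
  cstar_mul1r : left_id cstar_one cstar_mul;
  cstar_mulr1 : right_id cstar_one cstar_mul;
  cstar_mulDl : left_distributive cstar_mul +%R;
  cstar_mulDr : right_distributive cstar_mul +%R;
  cstar_scaleAl : forall (c : Cplx R) a b,
    c *: cstar_mul a b = cstar_mul (c *: a) b;
  cstar_scaleAr : forall (c : Cplx R) a b,
    c *: cstar_mul a b = cstar_mul a (c *: b);
  cstar_starK : involutive cstar_star;
  cstar_starD : {morph cstar_star : a b / a + b};
  cstar_starZ : forall (c : Cplx R) a,
    cstar_star (c *: a) = c^* *: cstar_star a;
  cstar_starM : forall a b,
    cstar_star (cstar_mul a b) = cstar_mul (cstar_star b) (cstar_star a);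
  cstar_normM : forall a b, `|cstar_mul a b| <= `|a| * `|b|;
  cstar_identity : forall a, `|cstar_mul (cstar_star a) a| = `|a| ^+ 2
}.

Definition cstar_sort (R : realType) (A : cstarAlgebra R) : Type :=
  cstar_module A.
Coercion cstar_sort : cstarAlgebra >-> Sortclass.

HB.instance Definition _ (R : realType) (A : cstarAlgebra R) :=
  CompleteNormedModule.copy (cstar_sort A) (cstar_module A).
#[warning="-redundant-canonical-projection"]
HB.instance Definition _ (R : realType) (A : cstarAlgebra R) :=
  GRing.Zmodule_isPzRing.Build (cstar_sort A)
    (@cstar_mulA R A) (@cstar_mul1r R A) (@cstar_mulr1 R A)
    (@cstar_mulDl R A) (@cstar_mulDr R A).

Definition star (R : realType) (A : cstarAlgebra R) : A -> A := @cstar_star R A.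

Section Cstar.
Variables (R : realType) (A : cstarAlgebra R).

(* Not necessarily unital. *)
Record cstar_subalgebra (D : set A) : Prop := {
  csub_closed : closed D;
  csub0 : D 0;
  csubD : forall a b, D a -> D b -> D (a + b);
  csubZ : forall (c : Cplx R) a, D a -> D (c *: a);
  csubM : forall a b, D a -> D b -> D (a * b);
  csub_star : forall a, D a -> D (star a)
}.

Definition cstar_generated (X : set A) : set A := smallest cstar_subalgebra X.

Definition commutative_set (D : set A) : Prop :=
  forall a b, D a -> D b -> a * b = b * a.

Definition maximal_abelian (D : set A) : Prop :=
  [/\ cstar_subalgebra D, commutative_set D &
      forall D', cstar_subalgebra D' -> commutative_set D' ->
        D `<=` D' -> D' = D].

Definition unitary (a : A) : Prop := star a * a = 1 /\ a * star a = 1.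

End Cstar.

(* *-homomorphisms defined on a *-subalgebra [D] of [A]; preservation of 1 is
   not required. *)
Record star_hom_on (R : realType) (A B : cstarAlgebra R) (D : set A)
    (f : A -> B) : Prop := {
  star_homD : forall a b, D a -> D b -> f (a + b) = f a + f b;
  star_homZ : forall (c : Cplx R) a, D a -> f (c *: a) = c *: f a;
  star_homM : forall a b, D a -> D b -> f (a * b) = f a * f b;
  star_hom_star : forall a, D a -> f (star a) = star (f a)
}.

Definition star_hom (R : realType) (A B : cstarAlgebra R) (f : A -> B) : Prop :=
  star_hom_on setT f.

Definition right_ideal (P : monoidType) (p : P) : set P :=
  range (fun x => (p * x)%g).

Record algebraic_dynamical_system (G : groupType) (P : monoidType)
    (theta : P -> {multiplicative G -> G}) : Prop := {
  ads_countable_group : countable [set: G];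
  ads_countable_monoid : countable [set: P];
  ads_left_cancel : forall p : P, injective (fun x => (p * x)%g);
  ads_right_LCM : forall p q : P,
    right_ideal p `&` right_ideal q = set0 \/
    exists r, right_ideal p `&` right_ideal q = right_ideal r;
  ads_injective : forall p, injective (theta p);
  ads_action1 : forall g, theta 1%g g = g;
  ads_actionM : forall p q g, theta (p * q)%g g = theta p (theta q g);
  ads_order : forall p q r,
    right_ideal p `&` right_ideal q = right_ideal r ->
    range (theta p) `&` range (theta q) = range (theta r)
}.

Section Index.
Variables (G : groupType) (f : {multiplicative G -> G}).

Definition image_coset (g : G) : set G := [set (g * f h)%g | h in setT].

(* [G : f(G)] < oo *)
Definition finite_index : Prop := finite_set (range image_coset).

(* [r] lists exactly one element of each left coset of f(G). *)
Definition transversal (r : seq G) : Prop :=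
  forall g, exists! i, (i < size r)%N /\ image_coset (nth 1%g r i) g.

End Index.

Section BoundaryQuotient.
Variables (R : realType) (G : groupType) (P : monoidType).
Variable theta : P -> {multiplicative G -> G}.

(* g = theta_p(g1) theta_q(g2), pP /\ qP = pp'P and pp' = qq' *)
Definition lcm_factorization (p q : P) (g g1 g2 : G) (p' q' : P) : Prop :=
  [/\ g = (theta p g1 * theta q g2)%g,
      right_ideal p `&` right_ideal q = right_ideal (p * p')%g &
      (p * p')%g = (q * q')%g].

Record boundary_relations (B : cstarAlgebra R) (u : G -> B) (s : P -> B) :
    Prop := {
  bq_unitary : forall g, unitary (u g);
  bq_u1 : u 1%g = 1;
  bq_uM : forall g h, u (g * h)%g = u g * u h;
  bq_isometry : forall p, star (s p) * s p = 1;
  bq_s1 : s 1%g = 1;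
  bq_sM : forall p q, s (p * q)%g = s p * s q;
  bq_I : forall p g, s p * u g = u (theta p g) * s p;
  bq_II : forall p q g g1 g2 p' q', lcm_factorization p q g g1 g2 p' q' ->
    star (s p) * u g * s q = u g1 * s p' * star (s q') * u g2;
  bq_II0 : forall p q g,
    ~ (exists g1 g2 p' q', lcm_factorization p q g g1 g2 p' q') ->
    star (s p) * u g * s q = 0;
  bq_III : forall p, finite_index (theta p) ->
    forall r, transversal (theta p) r ->
    \sum_(g <- r) u g * s p * star (s p) * star (u g) = 1
}.

Variables (Q : cstarAlgebra R) (u : G -> Q) (s : P -> Q).

(* (Q, u, s) is the universal C*-algebra generated by the relations. *)
Record boundary_quotient : Prop := {
  bq_relations : boundary_relations u s;
  bq_generated : cstar_generated (range u `|` range s) = setT;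
  bq_universal : forall (B : cstarAlgebra R) (v : G -> B) (t : P -> B),
    boundary_relations v t ->
    exists pi : Q -> B,
      [/\ star_hom pi, (forall g, pi (u g) = v g) & forall p, pi (s p) = t p]
}.

Definition CstarG : set Q := cstar_generated (range u).

Definition fixes_CstarG (alpha : Q -> Q) : Prop :=
  forall a, CstarG a -> alpha a = a.

Definition End_CstarG : set (Q -> Q) :=
  [set alpha | star_hom alpha /\ fixes_CstarG alpha].

Definition Aut_CstarG : set (Q -> Q) :=
  [set alpha | [/\ star_hom alpha, bijective alpha & fixes_CstarG alpha]].

(* The Pontryagin dual of the discrete group G: its unitary characters, with
   the topology of pointwise convergence. *)
Definition character_set : set (G -> Cplx R) :=
  [set chi | (forall g h, chi (g * h)%g = chi g * chi h) /\
             forall g, `|chi g| = 1].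

Definition dual_group : topologicalType :=
  initial_topology
    (fun chi : character_set => (\val chi : {ptws G -> Cplx R})).

Definition dual_eval (chi : dual_group) (g : G) : Cplx R :=
  \val (chi : character_set) g.

Lemma dual_pullback_subproof (f : {multiplicative G -> G}) (chi : dual_group) :
  (fun g => dual_eval chi (f g)) \in character_set.
Proof.
have /set_mem[chiM chi1] := valP (chi : character_set).
by apply/mem_set; split=> [g h|g]; rewrite /dual_eval ?gmulfM.
Qed.

Definition dual_pullback (f : {multiplicative G -> G}) (chi : dual_group) :
  dual_group := SigSub (dual_pullback_subproof f chi) : character_set.

Definition continuous_dual : set (dual_group -> Cplx R) :=
  [set a | continuous a].

(* Hom_theta(P, C(G^, T)).  On C(G^), theta~_p is pullback along
   chi |-> chi o theta_p, since it maps u_g = [chi |-> chi(g)] to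
   u_(theta_p(g)). *)
Definition twisted_hom_dual : set (P -> dual_group -> Cplx R) :=
  [set psi : P -> dual_group -> Cplx R |
     (forall p, continuous_dual (psi p) /\ forall chi, `|psi p chi| = 1) /\
     forall p q chi,
       psi (p * q)%g chi = psi p chi * psi q (dual_pullback (theta p) chi)].

(* The identification C(G^) = C*(G): a *-isomorphism of the continuous
   functions onto C*(G), with u_g corresponding to [chi |-> chi(g)]. *)
Record dual_identification (Phi : (dual_group -> Cplx R) -> Q) : Prop := {
  dual_idD : forall a b, continuous_dual a -> continuous_dual b ->
    Phi (a \+ b) = Phi a + Phi b;
  dual_idZ : forall (c : Cplx R) a, continuous_dual a ->
    Phi (fun chi => c * a chi) = c *: Phi a;
  dual_idM : forall a b, continuous_dual a -> continuous_dual b ->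
    Phi (a \* b) = Phi a * Phi b;
  dual_id_star : forall a, continuous_dual a ->
    Phi (fun chi => (a chi)^*) = star (Phi a);
  dual_id_bij : set_bij continuous_dual CstarG Phi;
  dual_id_u : forall g, Phi (fun chi => dual_eval chi g) = u g
}.

(* theta~_p as an endomorphism of C*(G) inside Q. *)
Definition theta_tilde (p : P) (T : Q -> Q) : Prop :=
  [/\ star_hom_on CstarG T, (forall a, CstarG a -> CstarG (T a)) &
      forall g, T (u g) = u (theta p g)].

(* Hom_theta(P, C(G^, T)) with C(G^, T) read as the unitary group of C*(G). *)
Definition twisted_hom_unitary : set (P -> Q) :=
  [set psi : P -> Q | (forall p, CstarG (psi p) /\ unitary (psi p)) /\
     forall p, exists2 T, theta_tilde p T &
       forall q, psi (p * q)%g = psi p * T (psi q)].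

(* [H] is a set of maps from P to a ring X containing the values of the
   twisted homomorphisms, and [emb] identifies these values with elements
   of Q. *)
Section Beta.
Variables (X : pzRingType) (H : set (P -> X)) (emb : X -> Q).

Definition abelian_group_pointwise : Prop :=
  [/\ H (cst 1),
      (forall psi phi, H psi -> H phi -> H (psi \* phi)),
      (forall psi phi, H psi -> H phi -> psi \* phi = phi \* psi) &
      forall psi, H psi -> exists2 phi, H phi & psi \* phi = cst 1].

Definition beta_formula (psi : P -> X) (alpha : Q -> Q) : Prop :=
  forall g p, alpha (u g * s p) = u g * emb (psi p) * s p.

(* The formula defines beta, the unique *-endomorphism satisfying it, as a
   homomorphism from H to Aut_{C*(G)} Q. *)
Definition beta_hom (beta : (P -> X) -> Q -> Q) : Prop :=
  [/\ abelian_group_pointwise,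
      set_fun H Aut_CstarG beta,
      (forall psi, H psi -> beta_formula psi (beta psi)),
      (forall psi alpha, H psi -> star_hom alpha -> beta_formula psi alpha ->
        alpha = beta psi) &
      forall psi phi, H psi -> H phi ->
        beta (psi \* phi) = beta psi \o beta phi].

Definition beta_theorem : Prop :=
  exists beta : (P -> X) -> Q -> Q,
    [/\ beta_hom beta,
        set_inj H beta &
        maximal_abelian CstarG ->
          set_bij H Aut_CstarG beta /\ End_CstarG = Aut_CstarG].

End Beta.

End BoundaryQuotient.

(* Main.v *)
Require Import Defs.
From mathcomp Require Import all_boot all_order all_algebra all_fingroup.
From mathcomp Require Import complex.
From mathcomp Require Import all_classical all_reals all_analysis.

Set Implicit Arguments.
Unset Strict Implicit.
Unset Printing Implicit Defensive.

Import Order.TTheory GRing.Theory Num.Theory.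
Import numFieldNormedType.Exports.

Local Open Scope classical_set_scope.
Local Open Scope ring_scope.

(** The formula for beta_psi says that a twisted homomorphism psi deforms the
    isometries s_p to psi_p s_p.  Since C*(G) is commutative and
    T_p(a) s_p = s_p a for a in C*(G), where T_p is the endomorphism induced by
    theta_p, the identity psi_(pq) = psi_p T_p(psi_q) is exactly what makes
    p |-> psi_p s_p multiplicative, and the other defining relations survive as
    well ([twisted_boundary_relations]).  The universal property then yields
    beta_psi; it fixes C*(G), and beta_psi o beta_phi = beta_(psi phi), so that
    beta_psi is invertible with inverse beta_(psi^star).

    Finiteness of the index enters through relation (III): for a transversal
    (g_i) of G / theta_p(G), the elements e_i = u_(g_i) s_p are isometries with
    orthogonal ranges adding up to 1 ([cuntz_cosets]).  So an element of the
    algebra is determined by its products with the u_g s_p ([cosets_cancel]),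
    which gives injectivity; T_p is the restriction to C*(G) of
    a |-> sum_i e_i a e_i^star ([theta_tilde_exists]); and an endomorphism alpha
    that fixes C*(G) is implemented on the u_g s_p by the unitary
    v_p = sum_i alpha(e_i) e_i^star ([End_CstarG_implemented]).  This unitary
    satisfies v_p u_g s_p = u_g alpha(s_p), hence commutes with every u_g.  If
    C*(G) is maximal abelian, v_p lies in it, p |-> v_p is a twisted
    homomorphism, and alpha = beta_v ([End_CstarG_twist]).

    All uniqueness statements on generated C*-subalgebras need the continuity
    of star-homomorphisms, which is purely algebraic data here.  It is obtained
    without spectral theory ([star_hom_on_bounded]): a small self-adjoint a is
    the real part of the unitary a + i sqrt(1 - a^2), and a star-homomorphism
    maps that unitary to an element of norm at most 1.

    The version over the dual group follows by transport along the
    identification Phi of C(G^) with C*(G), which turns pullback along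
    chi |-> chi o theta_p into T_p ([theta_tilde_dual]). *)

(** * Norm estimates and the star operation *)

Lemma closed_normP (K : numFieldType) (V : normedModType K) (E : set V) :
  closed E <->
  forall a, (forall e : K, 0 < e -> exists2 b, E b & `|a - b| < e) -> E a.
Proof.
split=> [cE a aE|EE].
  rewrite (closure_id E).1// => B /nbhs_ballP[e /= e0 eB].
  have [b Eb abe] := aE e e0; exists b; split=> //; apply: eB.
  by rewrite -ball_normE.
apply/closure_id/seteqP; split; first exact: subset_closure.
move=> a aE; apply: EE => e e0.
have [b [Eb]] := aE _ (nbhsx_ballx a e e0).
by rewrite -ball_normE; exists b.
Qed.

(** Take e = |x| / (C + 1).  The order of [K] may be partial, as over the complex
    numbers, but all scalars compared here are nonnegative, hence comparable. *)
Lemma norm0_small (K : numFieldType) (V : normedModType K) (x : V) (C : K) :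
  0 <= C -> (forall e : K, 0 < e -> `|x| <= C * e) -> x = 0.
Proof.
move=> C0 xC; apply/eqP/negPn/negP => x0.
have C1 : 0 < C + 1 by rewrite ltr_wpDl.
have nx0 : 0 < `|x| by rewrite normr_gt0.
have /xC : 0 < `|x| / (C + 1) by rewrite divr_gt0.
rewrite mulrCA ler_pMr// ler_pdivlMr// mul1r.
by rewrite real_leNgt ?ltrDl ?ltr01//; apply: ger0_real => //; exact: ltW.
Qed.

Lemma closed_eq_lipschitz (K : numFieldType) (V W : normedModType K)
    (D : set V) (f g : V -> W) (k : K) :
  closed D -> 0 <= k ->
  (forall a b, D a -> D b -> `|f a - f b| <= k * `|a - b|) ->
  (forall a b, D a -> D b -> `|g a - g b| <= k * `|a - b|) ->
  closed [set a | D a /\ f a = g a].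
Proof.
move=> cD k0 fk gk; apply/closed_normP => a aE.
have Da : D a.
  by move/closed_normP: cD; apply=> e /aE[b [Db _] ab]; exists b.
split=> //; apply/subr0_eq/(norm0_small (C := k + k)); first exact: addr_ge0.
move=> e /aE[b [Db fgb] ab].
rewrite -(subrKA (f b)) {2}fgb (le_trans (ler_normD _ _))// mulrDl.
have kab : k * `|a - b| <= k * e by rewrite ler_wpM2l// ltW.
apply: lerD; apply: le_trans kab; first exact: fk.
by rewrite distrC; apply: gk.
Qed.

Section CstarBasics.
Variables (R : realType) (A : cstarAlgebra R).
Implicit Types (a b x y : A) (c : Cplx R) (D X : set A).

Lemma starK a : star (star a) = a. Proof. exact: cstar_starK. Qed.
Lemma starD a b : star (a + b) = star a + star b.
Proof. exact: cstar_starD. Qed.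
Lemma starM a b : star (a * b) = star b * star a.
Proof. exact: cstar_starM. Qed.
Lemma starZ c a : star (c *: a) = c^* *: star a.
Proof. exact: cstar_starZ. Qed.
Lemma star0 : star (0 : A) = 0.
Proof. by apply: (addrI (star 0)); rewrite -starD !addr0. Qed.
Lemma starN a : star (- a) = - star a.
Proof. by apply: (addrI (star a)); rewrite -starD !subrr star0. Qed.
Lemma starB a b : star (a - b) = star a - star b.
Proof. by rewrite starD starN. Qed.
Lemma star1 : star (1 : A) = 1.
Proof. by rewrite -[LHS]mul1r -{1}[1]starK -starM mul1r starK. Qed.
Lemma star_sum (I : Type) (r : seq I) (F : I -> A) :
  star (\sum_(i <- r) F i) = \sum_(i <- r) star (F i).
Proof.
by elim/big_rec2: _ => [|i x y _ <-]; rewrite ?star0// starD.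
Qed.

Lemma cscaleAl c a b : c *: (a * b) = (c *: a) * b.
Proof. exact: cstar_scaleAl. Qed.
Lemma cscaleAr c a b : c *: (a * b) = a * (c *: b).
Proof. exact: cstar_scaleAr. Qed.
Lemma normM_le a b : `|a * b| <= `|a| * `|b|. Proof. exact: cstar_normM. Qed.
Lemma norm_starM a : `|star a * a| = `|a| ^+ 2.
Proof. exact: cstar_identity. Qed.

(** Submultiplicativity and the C*-identity give |b|^2 <= |b*| |b|, hence
    |b| <= |b*|, and b may be replaced by b*. *)
Lemma norm_star a : `|star a| = `|a|.
Proof.
have H b : `|b| <= `|star b|.
  have [->|b0] := eqVneq b 0; first by rewrite star0.
  have nb : 0 < `|b| by rewrite normr_gt0.
  by rewrite -(ler_pM2r nb) -expr2 -norm_starM normM_le.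
by apply/eqP; rewrite eq_le H andbT -{2}[a]starK H.
Qed.

Lemma closed_commute a : closed [set b : A | a * b = b * a].
Proof.
have -> : [set b : A | a * b = b * a] =
    [set b | [set: A] b /\ (fun b => a * b) b = (fun b => b * a) b].
  by apply/seteqP; split=> b //= [].
apply: (closed_eq_lipschitz (k := `|a|)) => //.
  by move=> b c _ _; rewrite -mulrBr normM_le.
by move=> b c _ _; rewrite -mulrBl (le_trans (normM_le _ _))// mulrC.
Qed.

Lemma closed_selfadjoint : closed [set b : A | star b = b].
Proof.
have -> : [set b : A | star b = b] =
    [set b | [set: A] b /\ @star R A b = idfun b].
  by apply/seteqP; split=> b //= [].
apply: (closed_eq_lipschitz (k := 1)) => //.
  by move=> b c _ _; rewrite -starB norm_star mul1r.
by move=> b c _ _; rewrite mul1r.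
Qed.

Lemma cstar_subalgebraT : cstar_subalgebra [set: A].
Proof. by split=> //; exact: closedT. Qed.

Lemma csubB D a b : cstar_subalgebra D -> D a -> D b -> D (a - b).
Proof.
by move=> sD Da Db; rewrite -scaleN1r; apply: csubD => //; exact: csubZ.
Qed.

Lemma cstar_generatedP X : cstar_subalgebra (cstar_generated X).
Proof.
split.
- by apply: closed_bigI => D [/csub_closed].
- by move=> D [sD _]; exact: csub0.
- by move=> a b Xa Xb D DX; case: (DX) => sD _; apply: csubD; [|exact: Xa|exact: Xb].
- by move=> c a Xa D DX; case: (DX) => sD _; apply: csubZ; [|exact: Xa].
- by move=> a b Xa Xb D DX; case: (DX) => sD _; apply: csubM; [|exact: Xa|exact: Xb].
- by move=> a Xa D DX; case: (DX) => sD _; apply: csub_star; [|exact: Xa].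
Qed.

Lemma sub_generated X : X `<=` cstar_generated X.
Proof. by move=> a Xa D [_]; exact. Qed.

Lemma generated_sub X D :
  cstar_subalgebra D -> X `<=` D -> cstar_generated X `<=` D.
Proof. by move=> sD XD a; exact. Qed.

End CstarBasics.

(** * Boundedness of star-homomorphisms *)

Lemma Cplx_pow2_small (R : realType) (e : Cplx R) :
  0 < e -> exists n, 2^-1 ^+ n < e.
Proof.
case: e => x y; rewrite ltcE /= => /andP[/eqP-> x0].
have [n xn] : exists n, x^-1 < n%:R.
  by exists (Num.bound x^-1); apply: archi_boundP; rewrite invr_ge0 ltW.
exists n.
have -> : (2^-1 : Cplx R) ^+ n = ((2^-1 : R) ^+ n)%:C%C.
  by rewrite rmorphXn fmorphV rmorph_nat.
rewrite ltcR exprVn invf_plt ?posrE ?exprn_gt0//.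
by apply: (lt_trans xn); rewrite -natrX ltr_nat ltn_expl.
Qed.

Lemma geometric_cauchy_limit (R : realType) (V : completeNormedModType (Cplx R))
    (y : nat -> V) :
  (forall n k, `|y (n + k)%N - y n| <= 2^-1 ^+ n) ->
  exists l, forall e : Cplx R, 0 < e ->
    exists N, forall n, (N <= n)%N -> `|l - y n| < e.
Proof.
move=> yC; have : cvg (y @ \oo).
  apply/cauchy_cvgP/cauchy_exP => e e0.
  have [n ne] := Cplx_pow2_small e0.
  exists (y n), n => // m /= nm.
  rewrite -ball_normE /= distrC; apply: le_lt_trans ne.
  by rewrite -(subnKC nm) yC.
move=> /cvg_ex[l yl]; exists l => e e0.
by have [n _ yn] := @cvgr_dist_lt _ _ _ _ _ _ _ yl e e0; exists n.
Qed.

Section Boundedness.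
Variable R : realType.
Implicit Types A B : cstarAlgebra R.

(** The element c is sqrt(1 - a^2) = 1 - y, where y solves y = (a^2 + y^2) / 2.
    On the ball of radius 1/2 the right-hand side is a contraction with factor
    1/2, and its iterates from 0 stay in [D], are self-adjoint and commute with
    a; so does their limit. *)
Lemma selfadjoint_complement A (D : set A) (a : A) :
  cstar_subalgebra D -> D 1 -> D a -> star a = a -> `|a| <= 2^-1 ->
  exists c, [/\ D c, star c = c, a * c = c * a & a * a + c * c = 1].
Proof.
move=> sD D1 Da sa na.
pose F (y : A) : A := (2^-1 : Cplx R) *: (a * a + y * y).
pose y n := iter n F 0.
have h0 : (0 : Cplx R) <= 2^-1 by rewrite invr_ge0.
have h2 : (2^-1 + 2^-1 : Cplx R) = 1.
  by rewrite -[RHS](divff (x := 2%:R)) ?pnatr_eq0// mulrDl mul1r.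
have h1 : (2^-1 : Cplx R) <= 1 by rewrite -[leRHS]h2 lerDl.
have nh : `|2^-1 : Cplx R| = 2^-1 by rewrite ger0_norm.
have sq (b : A) : `|b| <= 2^-1 -> `|b * b| <= 2^-1.
  move=> b1; apply: le_trans (normM_le _ _) _.
  by rewrite -[leRHS]mulr1 ler_pM// (le_trans b1).
have yP n : [/\ D (y n), star (y n) = y n, a * y n = y n * a & `|y n| <= 2^-1].
  elim: n => [|n [Dn sn cn nn]].
    by split; rewrite /y /= ?star0 ?mulr0 ?mul0r ?normr0//; exact: csub0.
  rewrite /y iterS -/(y n) /F; split.
  - by apply: csubZ => //; apply: csubD => //; exact: csubM.
  - by rewrite starZ starD !starM sa sn fmorphV rmorph_nat.
  - rewrite -cscaleAl -cscaleAr mulrDr mulrDl mulrA; congr (_ *: (_ + _)).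
    by rewrite mulrA cn -!mulrA cn.
  - rewrite normrZ nh -[leRHS]mulr1 ler_wpM2l//.
    by apply: le_trans (ler_normD _ _) _; rewrite -[leRHS]h2 lerD// sq.
have yC n k : `|y (n + k)%N - y n| <= 2^-1 ^+ n.
  elim: n => [|n IH].
    by rewrite add0n subr0 expr0; have [_ _ _ /le_trans->] := yP k.
  rewrite addSn /y !iterS -/(y n) -/(y (n + k)%N) /F -scalerBr normrZ nh.
  rewrite opprD addrACA subrr add0r exprS ler_wpM2l//.
  set p := y _; set q := y n.
  have -> : p * p - q * q = p * (p - q) + (p - q) * q.
    by rewrite mulrBr mulrBl addrA subrK.
  apply: le_trans (ler_normD _ _) _.
  apply: le_trans (lerD (normM_le _ _) (normM_le _ _)) _.
  rewrite (mulrC `|p - q| `|q|) -mulrDl -[leRHS]mul1r ler_pM ?addr_ge0//.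
  rewrite -[leRHS]h2 lerD//; first by have [] := yP (n + k)%N.
  by have [] := yP n.
have [l lP] := geometric_cauchy_limit yC.
have lE (E : set A) : closed E -> (forall n, E (y n)) -> E l.
  move=> /closed_normP cE Ey; apply: cE => e /lP[n yn].
  by exists (y n) => //; exact: yn.
have Fl : F l = l.
  apply/subr0_eq/(norm0_small (C := (`|l| + 1) + 1)); first by rewrite !addr_ge0.
  move=> e /lP[n yn].
  rewrite -(subrKA (y n.+1)) mulrDl mul1r.
  apply: le_trans (ler_normD _ _) _; rewrite lerD//; last first.
    by rewrite distrC ltW// yn.
  rewrite /y iterS -/(y n) /F -scalerBr normrZ nh opprD addrACA subrr add0r.
  apply: le_trans (_ : 1 * `|l * l - y n * y n| <= _).
    by rewrite ler_wpM2r.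
  rewrite mul1r -(subrKA (l * y n)) -mulrBr -mulrBl.
  apply: le_trans (ler_normD _ _) _.
  apply: le_trans (lerD (normM_le _ _) (normM_le _ _)) _.
  rewrite (mulrC `|l - y n| `|y n|) -mulrDl ler_pM ?addr_ge0//.
    by rewrite lerD2l; have [_ _ _ /le_trans->] := yP n.
  by rewrite ltW// yn.
have sl : star l = l.
  by apply: (lE _ (@closed_selfadjoint _ A)) => n; have [] := yP n.
have cl : a * l = l * a.
  by apply: (lE _ (closed_commute (a := a))) => n; have [] := yP n.
have Dl : D l by apply: lE => [|n]; [exact: csub_closed|have [] := yP n].
have l2 : a * a + l * l = l + l.
  by rewrite -{3 4}Fl /F -scalerDl h2 scale1r.
exists (1 - l); split.
- exact: csubB.
- by rewrite starB star1 sl.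
- by rewrite mulrBr mulrBl mul1r mulr1 cl.
- have -> : a * a = l + l - l * l by rewrite -l2 addrK.
  rewrite mulrBr mulr1 mulrBl mul1r opprB addrACA addKr.
  by rewrite -addrA -(addrA 1) -opprD addrCA subrr addr0.
Qed.

Lemma star_hom_on0 A B (D : set A) (f : A -> B) :
  D 0 -> star_hom_on D f -> f 0 = 0.
Proof. by move=> D0 hf; have := star_homZ hf 0 D0; rewrite !scale0r. Qed.

(** For small self-adjoint a, the element w = a + i sqrt(1 - a^2) is unitary, so
    f(w)* f(w) = f(1) is a projection and |f(w)| <= 1; as f(a) is the real part
    of f(w), also |f(a)| <= 1.  Scaling gives the bound on self-adjoint elements
    and the C*-identity extends it to all of [D].  The optimal constant is 1;
    the factor 2 comes from the radius 1/2 and suffices for continuity. *)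
Lemma star_hom_on_bounded A B (D : set A) (f : A -> B) :
  cstar_subalgebra D -> D 1 -> star_hom_on D f ->
  forall a, D a -> `|f a| <= 2 * `|a|.
Proof.
move=> sD D1 hf.
have f0 : f 0 = 0 by apply: star_hom_on0 hf; exact: csub0.
have small a : D a -> star a = a -> `|a| <= 2^-1 -> `|f a| <= 1.
  move=> Da sa na.
  have [c [Dc sc cac e1]] := selfadjoint_complement sD D1 Da sa na.
  pose i : Cplx R := 'i.
  pose w := a + i *: c.
  have Dw : D w by apply: csubD => //; exact: csubZ.
  have sw : star w = a - i *: c.
    by rewrite starD starZ sa sc conjCi scaleNr.
  have ww : star w * w = 1.
    rewrite sw /w mulrDr !mulrBl -!cscaleAl -!cscaleAr scalerA.
    by rewrite -(expr2 i) /i sqrCi scaleN1r opprK cac addrA subrK.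
  have np : `|f 1| <= 1.
    have /esym := norm_starM (f 1).
    rewrite -(star_hom_star hf)// -(star_homM hf) ?star1 ?mulr1// expr2.
    have [->//|p0] := eqVneq `|f 1| 0.
    by rewrite -{3}[`|f 1|]mulr1 => /(mulfI p0)->.
  have nw : `|f w| <= 1.
    rewrite -(@expr_le1 _ 2)// -norm_starM -(star_hom_star hf)//.
    by rewrite -(star_homM hf) ?ww//; apply: csub_star.
  have -> : f a = (2^-1 : Cplx R) *: (f w + star (f w)).
    rewrite -(star_hom_star hf)// -(star_homD hf)//; last exact: csub_star.
    rewrite sw addrACA subrr addr0.
    have -> : a + a = (2 : Cplx R) *: a by rewrite scaler_nat mulr2n.
    rewrite (star_homZ hf)//.
    by rewrite scalerA mulVf ?pnatr_eq0// scale1r.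
  rewrite normrZ ger0_norm ?invr_ge0// mulrC ler_pdivrMr// mul1r.
  apply: le_trans (ler_normD _ _) _.
  by rewrite norm_star -[leRHS](natrD _ 1 1) lerD.
have sadj a : D a -> star a = a -> `|f a| <= 2 * `|a|.
  move=> Da sa.
  have [->|a0] := eqVneq a 0; first by rewrite f0 !normr0 mulr0.
  have na : 0 < `|a| by rewrite normr_gt0.
  pose k : Cplx R := (2 * `|a|)^-1.
  have k0 : 0 < k by rewrite invr_gt0 mulr_gt0.
  have : `|f (k *: a)| <= 1.
    apply: small; first exact: csubZ.
      rewrite starZ sa; congr (_ *: _); apply: conj_Creal.
      by rewrite ger0_real// ltW.
    by rewrite normrZ (gtr0_norm k0) /k invfM mulrVK// unitfE gt_eqF.
  by rewrite (star_homZ hf)// normrZ (gtr0_norm k0) ler_pdivrMl ?mulr_gt0// mulr1.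
move=> a Da; rewrite -(@ler_pXn2r _ 2) ?nnegrE ?mulr_ge0//.
rewrite -norm_starM -(star_hom_star hf)// -(star_homM hf)//; last exact: csub_star.
have Das : D (star a * a) by apply: csubM => //; exact: csub_star.
apply: le_trans (sadj _ Das _) _; first by rewrite starM starK.
by rewrite norm_starM exprMn ler_wpM2r ?exprn_ge0// expr2 ler_peMr// ler1n.
Qed.

End Boundedness.

(** * Star-homomorphisms and commutants on generated subalgebras *)

Section StarHomomorphisms.
Variable R : realType.
Implicit Types A B : cstarAlgebra R.

Lemma star_hom_on_subset A B (D D' : set A) (f : A -> B) :
  D' `<=` D -> star_hom_on D f -> star_hom_on D' f.
Proof. by move=> sD [fD fZ fM fs]; split=> *; auto. Qed.

Lemma star_hom_comp A (f g : A -> A) :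
  star_hom f -> star_hom g -> star_hom (f \o g).
Proof.
move=> [fD fZ fM fs] [gD gZ gM gs]; split=> * /=.
- by rewrite gD// fD.
- by rewrite gZ// fZ.
- by rewrite gM// fM.
- by rewrite gs// fs.
Qed.

Lemma star_hom_onB A B (D : set A) (f : A -> B) (a b : A) :
  cstar_subalgebra D -> star_hom_on D f -> D a -> D b ->
  f (a - b) = f a - f b.
Proof.
move=> sD hf Da Db; rewrite -[- b]scaleN1r (star_homD hf)//.
  by rewrite (star_homZ hf)// scaleN1r.
exact: (csubZ sD).
Qed.

Lemma star_hom_on_lipschitz A B (D : set A) (f : A -> B) :
  cstar_subalgebra D -> D 1 -> star_hom_on D f ->
  forall a b, D a -> D b -> `|f a - f b| <= 2 * `|a - b|.
Proof.
move=> sD D1 hf a b Da Db; rewrite -(star_hom_onB sD)//.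
by apply: (star_hom_on_bounded sD D1 hf); exact: csubB.
Qed.

(** By continuity the coincidence set of [f] and [g] is closed, hence a
    C*-subalgebra. *)
Lemma star_hom_on_generated_eq A B (X : set A) (f g : A -> B) :
  cstar_generated X 1 ->
  star_hom_on (cstar_generated X) f -> star_hom_on (cstar_generated X) g ->
  (forall a, X a -> f a = g a) -> forall a, cstar_generated X a -> f a = g a.
Proof.
move=> D1 hf hg fg; have sD := cstar_generatedP X.
set D := cstar_generated X in D1 hf hg sD *.
suff : D `<=` [set a | D a /\ f a = g a] by move=> DE a /DE[].
apply: generated_sub => [|a Xa]; last by split; [exact: sub_generated|exact: fg].
split.
- apply: (closed_eq_lipschitz (k := 2)) => //; first exact: (csub_closed sD).
    exact: star_hom_on_lipschitz.
  exact: star_hom_on_lipschitz.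
- split; first exact: (csub0 sD).
  by rewrite (star_hom_on0 (csub0 sD) hf) (star_hom_on0 (csub0 sD) hg).
- move=> a b [Da Ea] [Db Eb]; split; first exact: (csubD sD).
  by rewrite (star_homD hf)// (star_homD hg)// Ea Eb.
- move=> c a [Da Ea]; split; first exact: (csubZ sD).
  by rewrite (star_homZ hf)// (star_homZ hg)// Ea.
- move=> a b [Da Ea] [Db Eb]; split; first exact: (csubM sD).
  by rewrite (star_homM hf)// (star_homM hg)// Ea Eb.
- move=> a [Da Ea]; split; first exact: (csub_star sD).
  by rewrite (star_hom_star hf)// (star_hom_star hg)// Ea.
Qed.

Lemma preimage_cstar_subalgebra A B (f : A -> B) (D : set B) :
  star_hom f -> cstar_subalgebra D -> cstar_subalgebra (f @^-1` D).
Proof.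
move=> hf sD; split => /=.
- apply/closed_normP => a aE; have /closed_normP cD := csub_closed sD.
  apply: cD => e e0; have /aE[b Db ab] : 0 < e / 2 by rewrite divr_gt0.
  exists (f b) => //.
  apply: le_lt_trans (star_hom_on_lipschitz (cstar_subalgebraT A) _ hf _ _) _ => //.
  by rewrite mulrC -ltr_pdivlMr.
- rewrite (star_hom_on0 _ hf)//; exact: (csub0 sD).
- by move=> a b Da Db; rewrite (star_homD hf)//; exact: (csubD sD).
- by move=> c a Da; rewrite (star_homZ hf)//; exact: (csubZ sD).
- by move=> a b Da Db; rewrite (star_homM hf)//; exact: (csubM sD).
- by move=> a Da; rewrite (star_hom_star hf)//; exact: (csub_star sD).
Qed.

Lemma commutant_cstar_subalgebra A (S : set A) :
  (forall a, S a -> S (star a)) ->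
  cstar_subalgebra [set b | forall a, S a -> a * b = b * a].
Proof.
move=> Ss; split => /=.
- have -> : [set b : A | forall a, S a -> a * b = b * a] =
      \bigcap_(a in S) [set b | a * b = b * a] by [].
  by apply: closed_bigI => a _; exact: closed_commute.
- by move=> a _; rewrite mulr0 mul0r.
- by move=> b c Hb Hc a Sa; rewrite mulrDr mulrDl Hb// Hc.
- by move=> k b Hb a Sa; rewrite -cscaleAl -cscaleAr Hb.
- by move=> b c Hb Hc a Sa; rewrite mulrA Hb// -!mulrA Hc.
- move=> b Hb a Sa; rewrite -[a]starK -!starM; congr star.
  by rewrite Hb//; exact: Ss.
Qed.

(** The commutant of [v] alone need not be closed under star, that of
    {v, v*} is; [v*] commutes with [X] because [X] is closed under star. *)
Lemma commute_cstar_generated A (X : set A) (v : A) :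
  (forall a, X a -> X (star a)) -> (forall a, X a -> a * v = v * a) ->
  forall a, cstar_generated X a -> a * v = v * a.
Proof.
move=> Xs Xv a Xa; pose S := [set b | b = v \/ b = star v].
have /(_ _ Xa) aS : cstar_generated X `<=` [set b | forall c, S c -> c * b = b * c].
  apply: generated_sub.
    apply: commutant_cstar_subalgebra => c [->|->]; first by right.
    by left; rewrite starK.
  move=> b Xb c [->|->]; first by rewrite Xv.
  by rewrite -[b]starK -!starM Xv//; exact: Xs.
by rewrite aS//; left.
Qed.

Lemma cstar_generated_commutative A (X : set A) :
  (forall a, X a -> X (star a)) -> commutative_set X ->
  commutative_set (cstar_generated X).
Proof.
move=> Xs cX; have sD := cstar_generatedP X.
have XD a b : X a -> cstar_generated X b -> b * a = a * b.
  by move=> Xa; apply: commute_cstar_generated => // c Xc; exact: cX.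
move=> a b Da Db; apply: esym; apply: commute_cstar_generated Db => // c Xc.
by rewrite (XD c a).
Qed.

(** [D] together with [v] and [v*] generates a commutative C*-subalgebra, which
    maximality forces to be [D]. *)
Lemma maximal_abelian_normal A (D : set A) (v : A) :
  maximal_abelian D -> star v * v = v * star v ->
  (forall a, D a -> a * v = v * a) -> D v.
Proof.
move=> [sD cD maxD] nv Dv.
have Dsv a : D a -> a * star v = star v * a.
  move=> Da; rewrite -[a]starK -!starM Dv//; exact: (csub_star sD).
pose X := D `|` [set v; star v].
rewrite -(maxD (cstar_generated X)).
- by apply: sub_generated; right; left.
- exact: cstar_generatedP.
- apply: cstar_generated_commutative => [a|a b].
    case=> [Da|[->|->]]; first by left; exact: (csub_star sD).
      by right; right.
    by right; left; exact: starK.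
  case=> [Da|[->|->]] [Db|[->|->]] //.
  + exact: cD.
  + exact: Dv.
  + exact: Dsv.
  + by rewrite Dv.
  + by rewrite Dsv.
- by move=> a Da; apply: sub_generated; left.
Qed.

End StarHomomorphisms.

(** * Cuntz families *)

Section CuntzFamilies.
Variables (R : realType) (A : cstarAlgebra R) (n : nat).
Implicit Types e x : 'I_n -> A.

(** The relations of the Cuntz algebra O_n: isometries with pairwise orthogonal
    ranges that add up to 1. *)
Definition cuntz_family e : Prop :=
  (forall i j, star (e i) * e j = (i == j)%:R) /\
  \sum_i e i * star (e i) = 1.

Lemma cuntz_sumM e x j : cuntz_family e ->
  (\sum_i x i * star (e i)) * e j = x j.
Proof.
move=> [eo _]; rewrite mulr_suml (bigD1 j)//= -mulrA eo eqxx mulr1.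
by rewrite big1 ?addr0// => i /negPf ij; rewrite -mulrA eo ij mulr0.
Qed.

Lemma cuntz_cancel e (a b : A) : cuntz_family e ->
  (forall i, a * e i = b * e i) -> a = b.
Proof.
move=> [_ e1] ab; rewrite -[a]mulr1 -[b]mulr1 -e1 !mulr_sumr.
by apply: eq_bigr => i _; rewrite !mulrA ab.
Qed.

(** This unitary carries [e i] to [x i].  Its adjoint is the same sum with [e] and
    [x] exchanged, so that one of the two identities implies the other. *)
Lemma cuntz_unitary e x : cuntz_family e -> cuntz_family x ->
  unitary (\sum_i x i * star (e i)).
Proof.
have H y z : cuntz_family y -> cuntz_family z ->
    (\sum_i z i * star (y i)) * star (\sum_i z i * star (y i)) = 1.
  move=> ye [_ z1]; rewrite star_sum mulr_sumr -[RHS]z1.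
  by apply: eq_bigr => i _; rewrite starM starK mulrA cuntz_sumM.
move=> he hx; split; last exact: H.
have -> : \sum_i x i * star (e i) = star (\sum_i e i * star (x i)).
  by rewrite star_sum; apply: eq_bigr => i _; rewrite starM starK.
by rewrite starK; exact: H.
Qed.

(** The canonical endomorphism of a Cuntz family. *)
Lemma cuntz_star_hom e : cuntz_family e ->
  star_hom (fun a => \sum_i e i * a * star (e i)).
Proof.
move=> he; split=> [a b _ _|c a _|a b _ _|a _].
- by rewrite -big_split; apply: eq_bigr => i _; rewrite mulrDr mulrDl.
- rewrite scaler_sumr; apply: eq_bigr => i _.
  by rewrite -cscaleAr -cscaleAl.
- rewrite mulr_sumr; apply: eq_bigr => i _.
  by rewrite -(mulrA (e i) b) [RHS]mulrA (cuntz_sumM (fun i => e i * a))// !mulrA.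
- rewrite star_sum; apply: eq_bigr => i _.
  by rewrite !starM starK mulrA.
Qed.

Lemma cuntz_image e (f : A -> A) : star_hom f -> f 1 = 1 ->
  cuntz_family e -> cuntz_family (f \o e).
Proof.
move=> hf f1 [eo e1].
have f0 : f 0 = 0 by rewrite (star_hom_on0 _ hf).
split=> [i j|] /=.
  by rewrite -(star_hom_star hf)// -(star_homM hf)// eo; case: eqP.
rewrite -[RHS]f1 -e1 (big_morph f (fun a b => star_homD hf I I) f0).
by apply: eq_bigr => i _; rewrite (star_homM hf)// (star_hom_star hf).
Qed.

End CuntzFamilies.

(** * Cosets of the image of an endomorphism *)

Section Cosets.
Variables (G : groupType) (f : {multiplicative G -> G}).

(** A map of groups that respects products respects 1 and inverses, although
    [{multiplicative G -> G}] records products only. *)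
Lemma morph_one : f 1%g = 1%g.
Proof. by apply: (mulgI (f 1%g)); rewrite -gmulfM !mulg1. Qed.

Lemma morph_inv g : f g^-1%g = (f g)^-1%g.
Proof. by apply: (mulgI (f g)); rewrite -gmulfM !mulgV morph_one. Qed.

Lemma image_coset_refl g : image_coset f g g.
Proof. by exists 1%g => //; rewrite morph_one mulg1. Qed.

Lemma image_coset_eq g h : image_coset f g h -> image_coset f h = image_coset f g.
Proof.
move=> [k _ <-]; apply/seteqP; split=> _ [l _ <-].
  by exists (k * l)%g => //; rewrite gmulfM mulgA.
by exists (k^-1 * l)%g => //; rewrite gmulfM morph_inv -mulgA mulKVg.
Qed.

Lemma transversal_exists : finite_index f -> exists r, Defs.transversal f r.
Proof.
move=> /finite_seqP[cs0 cs0E]; pose cs := undup cs0.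
have csE C : (C \in cs) <-> exists g, image_coset f g = C.
  rewrite mem_undup; split=> [Ccs|[g <-]].
    by have : [set` cs0] C by []; rewrite -cs0E => -[g _ <-]; exists g.
  have : range (image_coset f) (image_coset f g) by exists g.
  by rewrite cs0E.
pose rep C := xget 1%g [set g | image_coset f g = C].
have repE C : C \in cs -> image_coset f (rep C) = C.
  by move=> /csE Cg; exact: (xgetPex _ Cg).
exists (map rep cs) => g.
have gcs : image_coset f g \in cs by apply/csE; exists g.
exists (index (image_coset f g) cs); split.
  rewrite size_map index_mem; split=> //.
  rewrite (nth_map set0) ?index_mem// nth_index// repE//.
  exact: image_coset_refl.
move=> j []; rewrite size_map => jcs; rewrite (nth_map set0)//.
rewrite repE ?mem_nth// => gj.
have jE : image_coset f g = nth set0 cs j.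
  have /csE[h hE] := mem_nth set0 jcs.
  by rewrite -hE in gj *; exact: image_coset_eq.
by rewrite jE index_uniq// undup_uniq.
Qed.

End Cosets.

(** * C*(G) and the endomorphisms induced by the action *)

Section Dynamics.
Variables (R : realType) (G : groupType) (P : monoidType).
Variables (theta : P -> {multiplicative G -> G}).
Variables (Q : cstarAlgebra R) (u : G -> Q) (s : P -> Q).
Hypothesis dynamics : algebraic_dynamical_system theta.
Hypothesis cG : forall g h : G, commute g h.
Hypothesis cP : forall p q : P, commute p q.
Hypothesis findex : forall p : P, finite_index (theta p).
Hypothesis rel : boundary_relations theta u s.

Local Notation C := (CstarG u).
Let sC : cstar_subalgebra C := cstar_generatedP (range u).

(** As [P] is commutative, [p * q] lies in both right ideals, so the right LCM
    always exists. *)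
Lemma right_ideal_common (p q : P) : exists p' q',
  right_ideal p `&` right_ideal q = right_ideal (p * p')%g /\
  (p * p')%g = (q * q')%g.
Proof.
have [e0|[r rE]] := ads_right_LCM dynamics p q.
  have : (right_ideal p `&` right_ideal q) (p * q)%g.
    by split; [exists q|exists p => //; rewrite cP].
  by rewrite e0.
have [[p' _ p'E] [q' _ q'E]] : (right_ideal p `&` right_ideal q) r.
  by rewrite rE; exists 1%g => //; rewrite mulg1.
by exists p', q'; rewrite p'E q'E.
Qed.

Lemma CstarG_u g : C (u g).
Proof. by apply: sub_generated; exists g. Qed.

Lemma CstarG_1 : C 1.
Proof. by rewrite -(bq_u1 rel); exact: CstarG_u. Qed.

Lemma star_u g : star (u g) = u g^-1%g.
Proof.
have [_ uu] := bq_unitary rel g.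
rewrite -[LHS]mul1r -(bq_u1 rel) -(mulVg g) (bq_uM rel) -mulrA uu.
by rewrite mulr1.
Qed.

Lemma CstarG_commutative : commutative_set C.
Proof.
apply: cstar_generated_commutative => [_ [g _ <-]|_ _ [g _ <-] [h _ <-]].
  by rewrite star_u; exists g^-1%g.
by rewrite -!(bq_uM rel); congr u; exact: cG.
Qed.

(** Orthogonality of the ranges for different cosets is relation (II) with
    p = q: a factorization of g_i^-1 g_j would put g_j into the coset of g_i.
    That the ranges add up to 1 is relation (III). *)
Lemma cuntz_cosets p : exists n (r : 'I_n -> G),
  cuntz_family (fun i => u (r i) * s p) /\
  forall h, exists i k, h = (r i * theta p k)%g.
Proof.
have [r rT] := transversal_exists (findex p).
exists (size r), (fun i => nth 1%g r i); split; last first.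
  move=> h; have [i [[ir [k _ ik]] _]] := rT h.
  by exists (Ordinal ir), k.
split=> [i j|].
  rewrite starM star_u mulrA -(mulrA (star (s p))) -(bq_uM rel).
  have [<-|ij] := eqVneq i j.
    by rewrite mulVg (bq_u1 rel) mulr1 (bq_isometry rel).
  apply: (bq_II0 rel) => -[g1 [g2 [p' [q' [ijE _ _]]]]].
  have [k [_ kj]] := rT (nth 1%g r j).
  case/eqP: ij; apply/val_inj; rewrite /= -(kj i) ?(kj j)//; split=> //.
    exact: image_coset_refl.
  exists (g1 * g2)%g => //; by rewrite gmulfM -ijE mulKVg.
have := bq_III rel (findex p) rT; rewrite (big_nth 1%g) big_mkord => <-.
by apply: eq_bigr => i _; rewrite starM !mulrA.
Qed.

Lemma cosets_cancel p (a b : Q) :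
  (forall g, a * (u g * s p) = b * (u g * s p)) -> a = b.
Proof.
by move=> ab; have [n [r [re _]]] := cuntz_cosets p; exact: (cuntz_cancel re).
Qed.

(** Elements of C*(G) commute with the u_g, so that cancelling s_p alone
    suffices. *)
Lemma CstarG_cancel p (a b : Q) : C a -> C b -> a * s p = b * s p -> a = b.
Proof.
move=> Ca Cb ab; apply: (@cosets_cancel p) => g.
rewrite !mulrA !(CstarG_commutative _ (CstarG_u g))//.
by rewrite -!mulrA ab.
Qed.

Lemma theta_tilde_eq p (T T' : Q -> Q) :
  theta_tilde theta u p T -> theta_tilde theta u p T' ->
  forall a, C a -> T a = T' a.
Proof.
move=> [hT _ Tu] [hT' _ Tu']; apply: star_hom_on_generated_eq => //.
  exact: CstarG_1.
by move=> _ [g _ <-]; rewrite Tu Tu'.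
Qed.

(** T_p is the canonical endomorphism of the Cuntz family (u_(r_i) s_p).  It
    maps u_g to sum_i u_(r_i) s_p u_g s_p^star u_(r_i)^star, and the relation
    s_p u_g = u_(theta_p g) s_p together with commutativity of [G] moves
    u_(theta_p g) out of the sum. *)
Lemma theta_tilde_exists p : exists T : Q -> Q,
  theta_tilde theta u p T /\ forall a, C a -> T a * s p = s p * a.
Proof.
have [n [r [re rG]]] := cuntz_cosets p.
have hT := cuntz_star_hom re.
set T := (fun a => _) in hT.
have Tu g : T (u g) = u (theta p g).
  rewrite -[RHS]mulr1 -re.2 mulr_sumr; apply: eq_bigr => i _.
  rewrite !mulrA -(bq_uM rel) cG (bq_uM rel) -(mulrA (u (r i)) (s p)).
  by rewrite (bq_I rel) !mulrA.
exists T; split.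
  split=> //; first exact: star_hom_on_subset hT.
  apply: generated_sub; first exact: (preimage_cstar_subalgebra hT sC).
  by move=> _ [g _ <-] /=; rewrite Tu; exact: CstarG_u.
(* The coset of 1 is the only one whose summand survives on s_p. *)
move=> a Ca; have [i [k /esym ik]] := rG 1%g.
have -> : s p = u (r i) * s p * u k.
  by rewrite -mulrA (bq_I rel) mulrA -(bq_uM rel) ik (bq_u1 rel) mul1r.
rewrite mulrA (cuntz_sumM (fun i => u (r i) * s p * a) i re).
by rewrite -[RHS]mulrA (CstarG_commutative (CstarG_u k) Ca) !mulrA.
Qed.

Lemma theta_tilde_s p (T : Q -> Q) : theta_tilde theta u p T ->
  forall a, C a -> T a * s p = s p * a.
Proof.
move=> hT a Ca; have [T' [hT' T's]] := theta_tilde_exists p.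
by rewrite (theta_tilde_eq hT hT')// T's.
Qed.

Lemma theta_tilde_1 p (T : Q -> Q) : theta_tilde theta u p T -> T 1 = 1.
Proof. by move=> [_ _ Tu]; rewrite -(bq_u1 rel) Tu morph_one. Qed.

(** * Twisted homomorphisms *)

Section TwistedHom.
Variable psi : P -> Q.
Hypothesis Hpsi : twisted_hom_unitary theta u psi.

Lemma twisted_hom_C p : C (psi p). Proof. by have [] := Hpsi.1 p. Qed.

Lemma twisted_hom_unit p : unitary (psi p). Proof. by have [] := Hpsi.1 p. Qed.

Lemma twisted_homM p q (T : Q -> Q) : theta_tilde theta u p T ->
  psi (p * q)%g = psi p * T (psi q).
Proof.
move=> hT; have [T' hT' ->] := Hpsi.2 p.
by rewrite (theta_tilde_eq hT hT')//; exact: twisted_hom_C.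
Qed.

(** theta_1 is the identity, so psi_1 is a unitary with psi_1 = psi_1 psi_1. *)
Lemma twisted_hom_1 : psi 1%g = 1.
Proof.
have id1 : theta_tilde theta u 1%g id.
  by split=> // g; rewrite (ads_action1 dynamics).
have := twisted_homM 1%g id1; rewrite mulg1 => e1.
have [e2 _] := twisted_hom_unit 1%g.
by rewrite -[LHS]mul1r -e2 -mulrA -e1.
Qed.

(** Deforming s_p and s_q changes s_p^star u_g s_q only by factors in C*(G) on
    both sides: the two expressions of psi_(pp') = psi_(qq') give
    psi_p^star psi_q = T_p(psi_p') T_q(psi_q')^star, and these factors move past
    s_p^star and s_q.  Hence both cases of relation (II) pass to the deformed
    isometries. *)
Lemma twisted_star_s_u_s (p q p' q' : P) g : (p * p')%g = (q * q')%g ->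
  star (psi p * s p) * u g * (psi q * s q) =
  psi p' * (star (s p) * u g * s q) * star (psi q').
Proof.
move=> pq.
have [Tp hTp Ep] := Hpsi.2 p; have [Tq hTq Eq] := Hpsi.2 q.
have [sTp CTp _] := hTp; have [sTq CTq _] := hTq.
have Cs a : C a -> C (star a) by exact: (csub_star sC).
have Cpsi := twisted_hom_C.
have cross : star (psi p) * psi q = Tp (psi p') * Tq (star (psi q')).
  have [up _] := twisted_hom_unit p; have [_ uq] := twisted_hom_unit q'.
  have -> : Tp (psi p') = star (psi p) * (psi q * Tq (psi q')).
    by rewrite -Eq -pq Ep mulrA up mul1r.
  rewrite -!mulrA -(star_homM sTq (Cpsi _) (Cs _ (Cpsi _))) uq.
  by rewrite (theta_tilde_1 hTq) mulr1.
have sT : star (s p) * Tp (psi p') = psi p' * star (s p).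
  rewrite -[LHS]starK starM starK -(star_hom_star sTp (Cpsi _)).
  by rewrite (theta_tilde_s hTp (Cs _ (Cpsi _))) starM starK.
have middle : star (psi p) * u g * psi q = Tp (psi p') * u g * Tq (star (psi q')).
  rewrite (CstarG_commutative (Cs _ (Cpsi p)) (CstarG_u g)) -mulrA cross mulrA.
  by rewrite (CstarG_commutative (CstarG_u g) (CTp _ (Cpsi _))).
transitivity (star (s p) * (star (psi p) * u g * psi q) * s q).
  by rewrite starM !mulrA.
rewrite middle !mulrA sT -!mulrA (theta_tilde_s hTq (Cs _ (Cpsi _))).
by rewrite !mulrA.
Qed.

Lemma twisted_boundary_relations :
  boundary_relations theta u (fun p => psi p * s p).
Proof.
have Cp := twisted_hom_C.
have Cs a : C a -> C (star a) by exact: (csub_star sC).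
split.
- exact: (bq_unitary rel).
- exact: (bq_u1 rel).
- exact: (bq_uM rel).
- move=> p; have [up _] := twisted_hom_unit p.
  by rewrite starM mulrA -(mulrA (star (s p))) up mulr1 (bq_isometry rel).
- by rewrite twisted_hom_1 (bq_s1 rel) mulr1.
- move=> p q; have [T hT ->] := Hpsi.2 p.
  rewrite (bq_sM rel) mulrA -(mulrA _ _ (s p)) (theta_tilde_s hT)//.
  by rewrite !mulrA.
- move=> p g; rewrite -mulrA (bq_I rel) !mulrA; congr (_ * _).
  by apply: CstarG_commutative => //; exact: CstarG_u.
- move=> p q g g1 g2 p' q' fac; have [_ _ pq] := fac.
  rewrite (twisted_star_s_u_s _ pq) (bq_II rel fac) starM !mulrA.
  rewrite (CstarG_commutative (Cp p') (CstarG_u g1)) -!mulrA.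
  by rewrite (CstarG_commutative (CstarG_u g2) (Cs _ (Cp q'))).
- move=> p q g nfac; have [p' [q' [_ pq]]] := right_ideal_common p q.
  by rewrite (twisted_star_s_u_s _ pq) (bq_II0 rel nfac) mulr0 mul0r.
- move=> p fp r rT; have [_ up] := twisted_hom_unit p.
  rewrite -[RHS]up -[X in _ = X * _]mulr1 -(bq_III rel fp rT) mulr_sumr mulr_suml.
  apply: eq_bigr => g _; rewrite starM !mulrA.
  rewrite (CstarG_commutative (CstarG_u g) (Cp p)) -!mulrA; congr (_ * (_ * (_ * (_ * _)))).
  rewrite star_u; apply: CstarG_commutative; [exact: Cs|exact: CstarG_u].
Qed.

End TwistedHom.

Lemma twisted_hom_cst1 : twisted_hom_unitary theta u (cst 1).
Proof.
split=> p; last first.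
  have [T [hT _]] := theta_tilde_exists p; exists T => // q.
  by rewrite (theta_tilde_1 hT) /cst mulr1.
by split; [exact: CstarG_1 | split; rewrite star1 mulr1].
Qed.

Lemma twisted_hom_mul (psi phi : P -> Q) :
  twisted_hom_unitary theta u psi -> twisted_hom_unitary theta u phi ->
  twisted_hom_unitary theta u (psi \* phi).
Proof.
move=> Hpsi Hphi; have Cpsi := twisted_hom_C Hpsi; have Cphi := twisted_hom_C Hphi.
split=> p /=.
  split; first exact: (csubM sC).
  have [psi1 psi2] := twisted_hom_unit Hpsi p.
  have [phi1 phi2] := twisted_hom_unit Hphi p.
  split; rewrite starM mulrA.
    by rewrite -(mulrA (star (phi p))) psi1 mulr1.
  by rewrite -(mulrA (psi p)) phi2 mulr1.
have [T [hT _]] := theta_tilde_exists p; exists T => // q.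
have [sT CT _] := hT.
rewrite (twisted_homM Hpsi q hT) (twisted_homM Hphi q hT) (star_homM sT (Cpsi q) (Cphi q)).
rewrite !mulrA -!(mulrA (psi p)).
by rewrite (CstarG_commutative (CT _ (Cpsi q)) (Cphi p)).
Qed.

Lemma twisted_hom_star (psi : P -> Q) :
  twisted_hom_unitary theta u psi ->
  twisted_hom_unitary theta u (fun p => star (psi p)).
Proof.
move=> Hpsi; have Cpsi := twisted_hom_C Hpsi.
split=> p /=.
  split; first exact: (csub_star sC).
  by have [psi1 psi2] := twisted_hom_unit Hpsi p; split; rewrite starK.
have [T [hT _]] := theta_tilde_exists p; exists T => // q.
have [sT CT _] := hT.
rewrite (twisted_homM Hpsi q hT) starM (star_hom_star sT (Cpsi q)).
by apply: CstarG_commutative; apply: (csub_star sC) => //; exact: CT.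
Qed.

Lemma twisted_hom_group : abelian_group_pointwise (twisted_hom_unitary theta u).
Proof.
split.
- exact: twisted_hom_cst1.
- exact: twisted_hom_mul.
- move=> psi phi Hpsi Hphi; apply/funext => p /=.
  by apply: CstarG_commutative; exact: twisted_hom_C.
- move=> psi Hpsi; exists (fun p => star (psi p)); first exact: twisted_hom_star.
  by apply/funext => p /=; have [] := twisted_hom_unit Hpsi p.
Qed.

Lemma fixes_CstarGP (alpha : Q -> Q) : star_hom alpha ->
  (forall g, alpha (u g) = u g) -> fixes_CstarG u alpha.
Proof.
move=> ha au; apply: (star_hom_on_generated_eq (g := idfun)) => //.
- exact: CstarG_1.
- exact: star_hom_on_subset ha.
- by move=> _ [g _ <-]; exact: au.
Qed.

(** * The endomorphisms given by twisted homomorphisms *)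

Hypothesis bq : boundary_quotient theta u s.

Lemma boundary_quotient_hom_eq (alpha beta : Q -> Q) :
  star_hom alpha -> star_hom beta ->
  (forall g, alpha (u g) = beta (u g)) -> (forall p, alpha (s p) = beta (s p)) ->
  alpha = beta.
Proof.
move=> ha hb eu es; apply/funext => a.
apply: (@star_hom_on_generated_eq _ _ _ (range u `|` range s));
  rewrite ?(bq_generated bq)//.
by move=> _ [[g _ <-]|[p _ <-]].
Qed.

Definition twist_spec (psi : P -> Q) (alpha : Q -> Q) : Prop :=
  [/\ star_hom alpha, forall g, alpha (u g) = u g
    & forall p, alpha (s p) = psi p * s p].

(** The endomorphism beta_psi; the default value [id] is taken only off the
    twisted homomorphisms. *)
Definition twist_endo (psi : P -> Q) : Q -> Q := xget (id : Q -> Q) (twist_spec psi).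

Lemma twist_endoP (psi : P -> Q) : twisted_hom_unitary theta u psi ->
  twist_spec psi (twist_endo psi).
Proof.
by move=> /twisted_boundary_relations/(bq_universal bq)/(xgetPex (id : Q -> Q)).
Qed.

Lemma twist_endo_unique (psi : P -> Q) (alpha : Q -> Q) :
  twisted_hom_unitary theta u psi -> twist_spec psi alpha ->
  alpha = twist_endo psi.
Proof.
move=> /twist_endoP[hb bu bs] [ha au as_].
by apply: boundary_quotient_hom_eq => // [g|p]; rewrite ?au ?bu// as_ bs.
Qed.

(** The formula at p = 1 and at g = 1 prescribes the values on generators, since
    psi_1 = 1. *)
Lemma twist_specP (psi : P -> Q) (alpha : Q -> Q) :
  twisted_hom_unitary theta u psi -> star_hom alpha ->
  (twist_spec psi alpha <-> beta_formula u s id psi alpha).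
Proof.
move=> Hpsi ha; split=> [[_ au as_] g p|af].
  by rewrite (star_homM ha)// au as_ mulrA.
split=> // [g|p].
  by have := af g 1%g; rewrite (twisted_hom_1 Hpsi) (bq_s1 rel) !mulr1.
by have := af 1%g p; rewrite (bq_u1 rel) !mul1r.
Qed.

Lemma twist_endo_fixes (psi : P -> Q) : twisted_hom_unitary theta u psi ->
  fixes_CstarG u (twist_endo psi).
Proof. by move=> /twist_endoP[ha au _]; exact: fixes_CstarGP. Qed.

Lemma twist_endoM (psi phi : P -> Q) :
  twisted_hom_unitary theta u psi -> twisted_hom_unitary theta u phi ->
  twist_endo (psi \* phi) = twist_endo psi \o twist_endo phi.
Proof.
move=> Hpsi Hphi; apply/esym/twist_endo_unique; first exact: twisted_hom_mul.
have [ha au as_] := twist_endoP Hpsi; have [hb bu bs] := twist_endoP Hphi.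
split=> [|g|p] /=; first exact: star_hom_comp.
  by rewrite bu au.
rewrite bs (star_homM ha)// as_ (twist_endo_fixes Hpsi); last exact: twisted_hom_C.
by rewrite mulrA (CstarG_commutative (twisted_hom_C Hphi p) (twisted_hom_C Hpsi p)).
Qed.

Lemma twist_endo1 : twist_endo (cst 1) = id.
Proof.
apply/esym/twist_endo_unique; first exact: twisted_hom_cst1.
by split=> // p; rewrite mul1r.
Qed.

Lemma twist_endo_Aut (psi : P -> Q) : twisted_hom_unitary theta u psi ->
  Aut_CstarG u (twist_endo psi).
Proof.
move=> Hpsi; have [_ _ cm] := twisted_hom_group => /(_ _ Hpsi)[phi Hphi pp].
have pp' : phi \* psi = cst 1 by rewrite cm.
split; [by have [] := twist_endoP Hpsi| |exact: twist_endo_fixes].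
exists (twist_endo phi) => a.
  by have := congr1 (fun f => f a) (twist_endoM Hphi Hpsi); rewrite pp' twist_endo1.
by have := congr1 (fun f => f a) (twist_endoM Hpsi Hphi); rewrite pp twist_endo1.
Qed.

Lemma twist_endo_inj : set_inj (twisted_hom_unitary theta u) twist_endo.
Proof.
move=> psi phi /set_mem Hpsi /set_mem Hphi e; apply/funext => p.
apply: (@CstarG_cancel p); [exact: twisted_hom_C..|].
by have [_ _ <-] := twist_endoP Hpsi; have [_ _ <-] := twist_endoP Hphi; rewrite e.
Qed.

Lemma End_CstarG_1 (alpha : Q -> Q) : End_CstarG u alpha -> alpha 1 = 1.
Proof. by move=> [_ fa]; apply: fa; exact: CstarG_1. Qed.

(** alpha maps the Cuntz family (e_i) of [cuntz_cosets] to another one, and v is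
    the unitary between them.  Writing g = r_i theta_p(k) gives
    u_g s_p = e_i u_k, and alpha fixes u_k; so v is right for every g, not just
    for the chosen representatives. *)
Lemma End_CstarG_implemented (alpha : Q -> Q) p : End_CstarG u alpha ->
  exists2 v, unitary v & forall g, v * (u g * s p) = alpha (u g * s p).
Proof.
move=> Ea; have [ha fa] := Ea; have [n [r [re rG]]] := cuntz_cosets p.
have rae := cuntz_image ha (End_CstarG_1 Ea) re.
exists (\sum_i alpha (u (r i) * s p) * star (u (r i) * s p)).
  exact: cuntz_unitary re rae.
move=> g; have [i [k ->]] := rG g.
have -> : u (r i * theta p k)%g * s p = u (r i) * s p * u k.
  by rewrite -mulrA (bq_I rel) mulrA (bq_uM rel).
rewrite mulrA (cuntz_sumM (fun i => alpha (u (r i) * s p)) i re).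
by rewrite [RHS](star_homM ha)// (fa (u k))//; exact: CstarG_u.
Qed.

(** On the elements u_h s_p both u_g psi_p and psi_p u_g give
    u_(gh) alpha(s_p), so psi_p commutes with C*(G) and lies in it by
    maximality; the twisted multiplicativity is checked in the same way on the
    elements u_g s_(pq). *)
Lemma End_CstarG_twist (alpha : Q -> Q) :
  maximal_abelian C -> End_CstarG u alpha ->
  exists2 psi, twisted_hom_unitary theta u psi & twist_endo psi = alpha.
Proof.
move=> mC Ea; have [ha fa] := Ea.
have fu g : alpha (u g) = u g by apply: fa; exact: CstarG_u.
have vE p : exists v, unitary v /\ forall g, v * (u g * s p) = alpha (u g * s p).
  by have [v uv vE] := End_CstarG_implemented p Ea; exists v.
have {vE}[psi psiP] := choice vE.
have psiE p g : psi p * (u g * s p) = u g * alpha (s p).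
  by rewrite (psiP p).2 (star_homM ha)// fu.
have psis p : psi p * s p = alpha (s p).
  by have := psiE p 1%g; rewrite (bq_u1 rel) !mul1r.
have psiu p g : u g * psi p = psi p * u g.
  apply: (@cosets_cancel p) => h.
  rewrite -[LHS]mulrA psiE mulrA -(bq_uM rel).
  by rewrite -mulrA (mulrA (u g)) -(bq_uM rel) psiE.
have Cpsi p : C (psi p).
  apply: maximal_abelian_normal => //.
    by have [[-> ->] _] := psiP p.
  apply: commute_cstar_generated => [_ [g _ <-]|_ [g _ <-]] //.
  by rewrite star_u; exists g^-1%g.
have Hpsi : twisted_hom_unitary theta u psi.
  split=> p; first by have [] := psiP p.
  have [T [hT Ts]] := theta_tilde_exists p; exists T => // q.
  apply: (@cosets_cancel (p * q)%g) => g.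
  rewrite psiE (bq_sM rel) (star_homM ha)// -!psis -!mulrA.
  rewrite mulrA psiu -mulrA; congr (_ * _).
  have [_ CT _] := hT.
  rewrite [RHS]mulrA (CstarG_commutative (CT _ (Cpsi q)) (CstarG_u g)) -mulrA.
  by rewrite (mulrA (T _)) Ts// -!mulrA.
exists psi => //; apply/esym/twist_endo_unique => //.
by split.
Qed.

Lemma twisted_hom_unitary_beta :
  beta_theorem u s (twisted_hom_unitary theta u) id.
Proof.
exists twist_endo; split.
- split.
  + exact: twisted_hom_group.
  + by move=> psi Hpsi; exact: twist_endo_Aut.
  + move=> psi Hpsi; have spec := twist_endoP Hpsi; have [ha _ _] := spec.
    exact/twist_specP.
  + move=> psi alpha Hpsi ha /(twist_specP Hpsi ha).
    exact: twist_endo_unique.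
  + exact: twist_endoM.
- exact: twist_endo_inj.
move=> mC.
have AutE alpha : Aut_CstarG u alpha -> End_CstarG u alpha by case.
split.
  split; [by move=> psi Hpsi; exact: twist_endo_Aut|exact: twist_endo_inj|].
  by move=> alpha /AutE /(End_CstarG_twist mC)[psi Hpsi <-]; exists psi.
apply/seteqP; split=> [alpha /(End_CstarG_twist mC)[psi Hpsi <-]|//].
exact: twist_endo_Aut.
Qed.

(** The assertion depends on the twisted homomorphisms only through their
    values in Q. *)
Lemma beta_theorem_transfer (X : pzRingType) (H : set (P -> X))
    (H' : set (P -> Q)) (emb : X -> Q) :
  abelian_group_pointwise H ->
  set_bij H H' (fun psi => emb \o psi) ->
  (forall psi phi, H psi -> H phi ->
    emb \o (psi \* phi) = (emb \o psi) \* (emb \o phi)) ->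
  beta_theorem u s H' id -> beta_theorem u s H emb.
Proof.
move=> gH bijH embM [beta [[_ bA bf bu bM] bi bmax]].
have [HH' injH _] := bijH.
have H'_ psi : H psi -> H' (emb \o psi) by exact: HH'.
exists (fun psi => beta (emb \o psi)); split.
- split=> //.
  + by move=> psi /H'_; exact: bA.
  + by move=> psi /H'_; exact: bf.
  + by move=> psi alpha /H'_ Hpsi ha af; exact: bu.
  + by move=> psi phi Hpsi Hphi; rewrite embM// bM//; exact: H'_.
- move=> psi phi Hpsi Hphi /bi e; apply: injH => //; apply: e;
    by rewrite inE; apply: H'_; rewrite -inE.
- by move=> /bmax[bb ->]; split=> //; exact: (set_bij_comp bijH bb).
Qed.

End Dynamics.

(** * Continuous functions on the dual group *)

Section ContinuousDual.
Variables (R : realType) (G : groupType).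
Implicit Types a b : dual_group R G -> Cplx R.

Lemma continuous_dual_cst (c : Cplx R) : continuous_dual (fun _ : dual_group R G => c).
Proof. exact: cst_continuous. Qed.

Lemma continuous_dualD a b :
  continuous_dual a -> continuous_dual b -> continuous_dual (a \+ b).
Proof. by move=> ca cb chi; apply: continuousD; [exact: ca|exact: cb]. Qed.

Lemma continuous_dualM a b :
  continuous_dual a -> continuous_dual b -> continuous_dual (a \* b).
Proof. by move=> ca cb chi; apply: continuousM; [exact: ca|exact: cb]. Qed.

Lemma continuous_dualZ (c : Cplx R) a :
  continuous_dual a -> continuous_dual (fun chi => c * a chi).
Proof. by move=> ca; exact: (continuous_dualM (@continuous_dual_cst c) ca). Qed.

Lemma continuous_dual_conj a :
  continuous_dual a -> continuous_dual (fun chi => (a chi)^*).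
Proof.
have conj_continuous : continuous (fun z : Cplx R => z^*).
  move=> z A /nbhs_ballP[e e0 eA]; apply/nbhs_ballP; exists e => // w.
  rewrite -ball_normE /= => zw; apply: eA.
  by rewrite -ball_normE /= -rmorphB norm_conjC.
by move=> ca chi; apply: continuous_comp; [exact: ca|exact: conj_continuous].
Qed.

Lemma continuous_dual_eval g :
  continuous_dual (fun chi : dual_group R G => dual_eval chi g).
Proof.
move=> chi; apply: (@continuous_comp _ {ptws G -> Cplx R} _
  (fun chi : dual_group R G => \val (chi : @character_set R G)) (fun h => h g)).
  exact: initial_continuous.
exact: (@proj_continuous G (fun=> Cplx R) g).
Qed.

(** In the topology of pointwise convergence, it suffices that evaluation at g
    after the pullback is evaluation at f(g). *)
Lemma dual_pullback_continuous (f : {multiplicative G -> G}) :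
  continuous (@dual_pullback R G f).
Proof.
apply: continuous_comp_initial => chi.
have Fchi := fmap_filter (fun x => \val (dual_pullback f x : @character_set R G))
  (@nbhs_filter (dual_group R G) chi).
apply/(@cvg_sup _ _ _ _ _ Fchi) => g.
apply: (@continuous_comp_initial _ _ _ (fun h : G -> Cplx R => h g)
  (fun chi : dual_group R G => \val (dual_pullback f chi : @character_set R G))).
exact: (@continuous_dual_eval (f g)).
Qed.

Lemma continuous_dual_pullback (f : {multiplicative G -> G}) a :
  continuous_dual a -> continuous_dual (a \o dual_pullback f).
Proof.
move=> ca chi; apply: continuous_comp; last exact: ca.
exact: dual_pullback_continuous.
Qed.

End ContinuousDual.

(** * Transport to the dual group *)

Section DualPicture.
Variables (R : realType) (G : groupType) (P : monoidType).
Variables (theta : P -> {multiplicative G -> G}).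
Variables (Q : cstarAlgebra R) (u : G -> Q) (s : P -> Q).
Hypothesis rel : boundary_relations theta u s.
Variable Phi : (dual_group R G -> Cplx R) -> Q.
Hypothesis idPhi : dual_identification u Phi.

Local Notation C := (CstarG u).
Implicit Types a b : dual_group R G -> Cplx R.

Lemma dual_id_C a : continuous_dual a -> C (Phi a).
Proof. by have [fPhi _ _] := dual_id_bij idPhi; exact: fPhi. Qed.

Lemma dual_id_inj a b :
  continuous_dual a -> continuous_dual b -> Phi a = Phi b -> a = b.
Proof.
by have [_ iPhi _] := dual_id_bij idPhi => ca cb; apply: iPhi; exact/mem_set.
Qed.

Lemma dual_id_surj x : C x -> exists2 a, continuous_dual a & Phi a = x.
Proof.
by have [_ _ sPhi] := dual_id_bij idPhi => /sPhi[a]; exists a.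
Qed.

Lemma dual_id_1 : Phi (fun _ => 1) = 1.
Proof.
rewrite -(bq_u1 rel) -(dual_id_u idPhi); congr Phi; apply/funext => chi.
have /set_mem[chiM chi1] := valP (chi : @character_set R G).
have chi0 : dual_eval chi 1%g != 0 by rewrite -normr_eq0 chi1 oner_eq0.
by apply: (mulfI chi0); rewrite mulr1 /dual_eval -chiM mulg1.
Qed.

(** Conjugating the pullback along chi |-> chi o theta_p with Phi gives a
    star-homomorphism that sends u_g to u_(theta_p(g)). *)
Lemma theta_tilde_dual p : exists2 T : Q -> Q, theta_tilde theta u p T &
  forall a, continuous_dual a -> T (Phi a) = Phi (a \o dual_pullback (theta p)).
Proof.
have /choice[inv invP] : forall x, exists a, C x -> continuous_dual a /\ Phi a = x.
  move=> x; have [/dual_id_surj[a ca ax]|nx] := pselect (C x); first by exists a.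
  by exists (fun _ => 0).
pose T x := Phi (inv x \o dual_pullback (theta p)).
have TE a : continuous_dual a -> T (Phi a) = Phi (a \o dual_pullback (theta p)).
  move=> ca; have [cinv invE] := invP _ (dual_id_C ca).
  by rewrite /T (dual_id_inj cinv ca invE).
have cpull a : continuous_dual a -> continuous_dual (a \o dual_pullback (theta p)).
  exact: continuous_dual_pullback.
exists T => //; split.
- split.
  + move=> _ _ /dual_id_surj[a ca <-] /dual_id_surj[b cb <-].
    rewrite -(dual_idD idPhi ca cb) (TE _ (continuous_dualD ca cb)) (TE a ca) (TE b cb).
    exact: (dual_idD idPhi (cpull a ca) (cpull b cb)).
  + move=> c _ /dual_id_surj[a ca <-].
    rewrite -(dual_idZ idPhi c ca) (TE _ (continuous_dualZ (c := c) ca)) (TE a ca).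
    exact: (dual_idZ idPhi c (cpull a ca)).
  + move=> _ _ /dual_id_surj[a ca <-] /dual_id_surj[b cb <-].
    rewrite -(dual_idM idPhi ca cb) (TE _ (continuous_dualM ca cb)) (TE a ca) (TE b cb).
    exact: (dual_idM idPhi (cpull a ca) (cpull b cb)).
  + move=> _ /dual_id_surj[a ca <-].
    rewrite -(dual_id_star idPhi ca) (TE _ (continuous_dual_conj ca)) (TE a ca).
    exact: (dual_id_star idPhi (cpull a ca)).
- move=> _ /dual_id_surj[a ca <-]; rewrite (TE a ca).
  exact: (dual_id_C (cpull a ca)).
- move=> g; rewrite -!(dual_id_u idPhi) (TE _ (continuous_dual_eval (g := g))).
  by [].
Qed.

Lemma unitary_dual_id a : continuous_dual a ->
  unitary (Phi a) <-> forall chi, `|a chi| = 1.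
Proof.
move=> ca; have cca := continuous_dual_conj ca.
pose n2 : dual_group R G -> Cplx R := fun chi => `|a chi| ^+ 2.
have n2E : (fun chi => (a chi)^*) \* a = n2.
  by apply/funext => chi; rewrite /n2 normCKC.
have n2E' : a \* (fun chi => (a chi)^*) = n2.
  by apply/funext => chi; rewrite /n2 normCK.
have cn2 : continuous_dual n2 by rewrite -n2E; exact: continuous_dualM cca ca.
have aE : star (Phi a) * Phi a = Phi n2.
  by rewrite -(dual_id_star idPhi ca) -(dual_idM idPhi cca ca) n2E.
have aE' : Phi a * star (Phi a) = Phi n2.
  by rewrite -(dual_id_star idPhi ca) -(dual_idM idPhi ca cca) n2E'.
split=> [[e1 _] chi|a1]; last first.
  have n21 : n2 = fun _ => 1 by apply/funext => chi; rewrite /n2 a1 expr1n.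
  by split; rewrite ?aE ?aE' n21 dual_id_1.
have n21 : n2 = fun _ => 1.
  apply: (dual_id_inj cn2 (@continuous_dual_cst R G 1)).
  by rewrite dual_id_1 -aE.
have /eqP : n2 chi = 1 by rewrite n21.
rewrite /n2 sqrf_eq1 => /orP[/eqP//|/eqP e].
by have := normr_ge0 (a chi); rewrite e oppr_ge0 ler10.
Qed.

Lemma twisted_hom_dual_bij :
  set_bij (@twisted_hom_dual R G P theta) (twisted_hom_unitary theta u)
    (fun psi => Phi \o psi).
Proof.
split.
- move=> psi [cpsi psiM]; split=> p /=.
    have [ca a1] := cpsi p.
    by split; [exact: (dual_id_C ca)|exact/(unitary_dual_id ca)].
  have [T hT TE] := theta_tilde_dual p; exists T => // q.
  have [cp _] := cpsi p; have [cq _] := cpsi q.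
  rewrite (TE _ cq) -(dual_idM idPhi cp (continuous_dual_pullback cq)).
  by congr Phi; apply/funext => chi; exact: psiM.
- move=> psi phi /set_mem[cpsi _] /set_mem[cphi _] e; apply/funext => p.
  have [cp _] := cpsi p; have [cp' _] := cphi p.
  by apply: (dual_id_inj cp cp'); exact: (congr1 (fun f => f p) e).
- move=> psi Hpsi.
  have /choice[phi phiE] : forall p, exists a, continuous_dual a /\ Phi a = psi p.
    move=> p; by have [a ca aE] := dual_id_surj (twisted_hom_C Hpsi p); exists a.
  exists phi; last by apply/funext => p; exact: (phiE p).2.
  split=> [p|p q].
    split; first exact: (phiE p).1.
    apply/(unitary_dual_id (phiE p).1).
    by rewrite (phiE p).2; exact: (twisted_hom_unit Hpsi p).
  have [T hT TE] := theta_tilde_dual p.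
  have [cp pE] := phiE p; have [cq qE] := phiE q; have [cpq pqE] := phiE (p * q)%g.
  have cq' := continuous_dual_pullback (f := theta p) cq.
  suff : phi (p * q)%g = phi p \* (phi q \o dual_pullback (theta p)).
    by move=> /[swap] chi /(congr1 (fun f => f chi)).
  apply: (dual_id_inj cpq (continuous_dualM cp cq')).
  rewrite (dual_idM idPhi cp cq') -(TE _ cq) pE qE pqE.
  exact: (twisted_homM rel Hpsi q hT).
Qed.

Lemma twisted_hom_dual_group :
  abelian_group_pointwise (@twisted_hom_dual R G P theta).
Proof.
split.
- split=> [p|p q chi]; last by rewrite /cst /= mulr1.
  by split=> [|chi]; [exact: continuous_dual_cst|exact: normr1].
- move=> psi phi [cpsi psiM] [cphi phiM]; split=> [p|p q chi].
    have [ca a1] := cpsi p; have [cb b1] := cphi p.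
    by split=> [|chi /=]; [exact: (continuous_dualM ca cb)|rewrite normrM a1 b1 mulr1].
  by rewrite /= /GRing.mul/= psiM phiM mulrACA.
- by move=> psi phi _ _; apply/funext => p; apply/funext => chi; exact: mulrC.
- move=> psi [cpsi psiM]; exists (fun p chi => (psi p chi)^*).
    split=> [p|p q chi]; last by rewrite psiM rmorphM.
    have [ca a1] := cpsi p.
    by split=> [|chi]; [exact: (continuous_dual_conj ca)|rewrite norm_conjC].
  apply/funext => p; apply/funext => chi; have [_ a1] := cpsi p.
  transitivity (psi p chi * (psi p chi)^*) => //.
  by rewrite -normCK a1 expr1n.
Qed.

End DualPicture.

Theorem theorem6p2 (R : realType) (G : groupType) (P : monoidType)
    (theta : P -> {multiplicative G -> G})
    (Q : cstarAlgebra R) (u : G -> Q) (s : P -> Q) :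
  algebraic_dynamical_system theta ->
  (forall g h : G, commute g h) ->
  (forall p q : P, commute p q) ->
  (forall p : P, finite_index (theta p)) ->
  boundary_quotient theta u s ->
  (forall Phi : (dual_group R G -> Cplx R) -> Q,
     dual_identification u Phi ->
     beta_theorem u s (@twisted_hom_dual R G P theta) Phi) /\
  beta_theorem u s (twisted_hom_unitary theta u) id.
Proof.
move=> dynamics cG cP findex bq; have rel := bq_relations bq.
have unitary_case : beta_theorem u s (twisted_hom_unitary theta u) id.
  exact: twisted_hom_unitary_beta.
split=> // Phi idPhi.
apply: (beta_theorem_transfer _ _ _ unitary_case).
- exact: twisted_hom_dual_group.
- exact: (twisted_hom_dual_bij rel idPhi).
- move=> psi phi [cpsi _] [cphi _]; apply/funext => p.
  have [cp _] := cpsi p; have [cp' _] := cphi p.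
  exact: (dual_idM idPhi cp cp').
Qed.
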